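(* Let $\pi$ be a probability density on $\mathbb{R}^d$ with $\pi(x)>0$ for all $x$ and $\log\pi\in C^1(\mathbb{R}^d)$. For $\lambda>0$ let $\pi^{(\lambda)}(x):=\lambda^{-1}\pi(x_1/\lambda,x_2,\dots,x_d)$. Let $\mu$ be a centred symmetric probability density on $\mathbb{R}^d$ satisfying the following condition: there exists $\lambda_0>0$ such that for all $x,y\in\mathbb{R}^d$ and all $\lambda<\lambda_0$ we have $\mu(\delta_\lambda)\ge\mu(\delta)$, where $\delta=y-x$ and $\delta_\lambda=(\lambda(y_1-x_1),y_2-x_2,\dots,y_d-x_d)$; and moreover $\sup_{\xi_1\in\mathbb{R}}\mu_1(\xi_1)<\infty$, where $\mu_1(\xi_1)=\int_{\mathbb{R}^{d-1}}\mu(\xi_1,\xi_2,\dots,\xi_d)\,d\xi_2\cdots d\xi_d$. Fix $\sigma>0$ and let $P^R_\lambda$ be the Metropolis--Hastings kernel with target $\pi^{(\lambda)}$ and random walk candidate kernel $Q^R(x,dy)=\sigma^{-d}\mu((y-x)/\sigma)\,dy$ (i.e. $y=x+\sigma\xi$, $\xi\sim\mu$). Assume $\mathrm{Gap}(P^R_1)>0$. Then $\mathrm{Gap}(P^R_\lambda)=\Theta(\lambda)$ as $\lambda\downarrow 0$.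
   Context: Metropolis--Hastings kernel with target density $\pi$ and candidate kernel $Q(x,dy)=q(x,y)dy$: $P(x,dy)=\alpha(x,y)Q(x,dy)+r(x)\delta_x(dy)$ with $\alpha(x,y)=\min\{1,\pi(y)q(y,x)/(\pi(x)q(x,y))\}$ and $r(x)=1-\int\alpha(x,y)Q(x,dy)$. For a $\pi$-reversible kernel $P$, $\mathrm{Gap}(P)=\inf_{f\in L^2_{0,1}(\pi)}\frac12\int (f(y)-f(x))^2\pi(dx)P(x,dy)$, where $L^2_{0,1}(\pi)=\{f:\mathbb{E}_\pi f=0,\ \mathrm{Var}_\pi f=1\}$. For positive functions, $F(\lambda)=\Theta(G(\lambda))$ as $\lambda\downarrow0$ means $\liminf_{\lambda\downarrow0}F/G>0$ and $\limsup_{\lambda\downarrow0}F/G<\infty$. *)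

(* Defs.v *)
From HB Require Import structures.
From mathcomp Require Import all_boot all_order all_algebra.
From mathcomp Require Import all_classical all_reals all_analysis.

Set Implicit Arguments.
Unset Strict Implicit.
Unset Printing Implicit Defensive.

Import Order.TTheory GRing.Theory Num.Theory.
Import numFieldNormedType.Exports.
Local Open Scope classical_set_scope.
Local Open Scope ring_scope.

Section Defs.
Variable R : realType.

(* Lebesgue integral on R^n (points = n.-tuple R) of an extended-real
   integrand, as the iterated one-dimensional Lebesgue integral.  It is only
   applied to nonnegative integrands, for which (Tonelli) it coincides with
   the integral w.r.t. n-dimensional Lebesgue measure. *)
Fixpoint iint (n : nat) : (n.-tuple R -> \bar R) -> \bar R :=
  match n return (n.-tuple R -> \bar R) -> \bar R with
  | 0 => fun f => f [tuple]
  | m.+1 => fun f =>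
      (\int[@lebesgue_measure R]_x iint (fun v => f (cons_tuple x v)))%E
  end.

Variable n : nat.
Notation d := n.+1.
Notation Rd := (d.-tuple R).

Definition tsub (y x : Rd) : Rd := [tuple tnth y i - tnth x i | i < d].
Definition tscale (c : R) (x : Rd) : Rd := [tuple c * tnth x i | i < d].
Definition scale1 (c : R) (x : Rd) : Rd :=
  [tuple (if i == ord0 then c * tnth x i else tnth x i) | i < d].

Definition tuple_of_row (v : 'rV[R]_d) : Rd := [tuple v ord0 i | i < d].

Definition is_density (p : Rd -> R) :=
  measurable_fun setT p /\ (forall x, 0 <= p x) /\ iint (fun x => (p x)%:E) = 1%E.

Definition log_C1 (p : Rd -> R) :=
  let lp := fun v : 'rV[R]_d => ln (p (tuple_of_row v)) in
  (forall v, differentiable lp v) /\ (forall u, continuous (fun v => 'd lp v u)).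

Definition rescaled (p : Rd -> R) (lam : R) : Rd -> R :=
  fun x => lam^-1 * p (scale1 lam^-1 x).

Definition rw_q (mu : Rd -> R) (sigma : R) (x y : Rd) : R :=
  sigma ^- d * mu (tscale sigma^-1 (tsub y x)).

Definition mh_alpha (p : Rd -> R) (q : Rd -> Rd -> R) (x y : Rd) : R :=
  Num.min 1 (p y * q y x / (p x * q x y)).

Definition mh_r (p : Rd -> R) (q : Rd -> Rd -> R) (x : Rd) : \bar R :=
  (1%E - iint (fun y => (mh_alpha p q x y * q x y)%:E))%E.

(* integral of a nonnegative g against P(x,dy) = alpha(x,y)Q(x,dy) + r(x)delta_x(dy) *)
Definition mh_kint (p : Rd -> R) (q : Rd -> Rd -> R) (x : Rd)
    (g : Rd -> \bar R) : \bar R :=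
  (iint (fun y => (mh_alpha p q x y * q x y)%:E * g y) + mh_r p q x * g x)%E.

Definition expect (p : Rd -> R) (f : Rd -> R) : \bar R :=
  (iint (fun x => (Num.max (f x) 0 * p x)%:E)
   - iint (fun x => (Num.max (- f x) 0 * p x)%:E))%E.

Definition variance (p : Rd -> R) (f : Rd -> R) : \bar R :=
  iint (fun x => ((f x)%:E - expect p f) ^+ 2 * (p x)%:E)%E.

Definition L2_01 (p : Rd -> R) : set (Rd -> R) :=
  [set f | measurable_fun setT f /\ expect p f = 0%E /\ variance p f = 1%E].

Definition dirichlet (p : Rd -> R) (q : Rd -> Rd -> R) (f : Rd -> R) : \bar R :=
  ((2^-1)%:E * iint (fun x => (p x)%:E *
     mh_kint p q x (fun y => ((f y - f x) ^+ 2)%:E)))%E.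

Definition Gap (p : Rd -> R) (q : Rd -> Rd -> R) : \bar R :=
  ereal_inf [set dirichlet p q f | f in L2_01 p].

End Defs.

(* Main.v *)
Require Import Defs.
From HB Require Import structures.
From mathcomp Require Import all_boot all_order all_algebra.
From mathcomp Require Import all_classical all_reals all_analysis.
From mathcomp Require Import measurable_realfun ring lra.
Set Implicit Arguments.
Unset Strict Implicit.
Unset Printing Implicit Defensive.

Import Order.TTheory GRing.Theory Num.Theory.
Import numFieldNormedType.Exports.
Local Open Scope classical_set_scope.
Local Open Scope ring_scope.

(* Write [S] for the dilation [scale1 lam].  Substituting [x = S u], [y = S v]
   in the Dirichlet form of the rescaled chain gives
     [lam / 2 * iint iint min (pi u) (pi v) q (S u) (S v) (g v - g u)^2],
   where [g = f \o S] runs over the normalised test functions for [pi].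
   Since [q (S u) (S v) >= q u v], this is at least [lam] times the Dirichlet
   form of the unscaled chain, whence the lower bound.  For the upper bound take
   for [g] the normalised indicator [h] of the strip [0 <= x_1 <= 1]: then
   [(h v - h u)^2 <= h v + h u], each term is estimated by keeping in the minimum
   the density at the point where [h] is not evaluated, and the remaining
   integral of [q (S u) (S v)] over the strip is bounded, uniformly in [lam], by
   the supremum of the first marginal of [mu] divided by [sigma]. *)

(** * Measurability and Tonelli's theorem for iterated integrals *)

Section IteratedIntegral.
Context {R : realType}.
Local Open Scope ereal_scope.

Lemma eq_iint m (f g : m.-tuple R -> \bar R) : f =1 g -> iint f = iint g.
Proof. by move=> /funext ->. Qed.

Lemma iint_ge0 m (f : m.-tuple R -> \bar R) :
  (forall v, 0 <= f v) -> 0 <= iint f.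
Proof.
by elim: m f => [|m IH] f f0 //=; apply: integral_ge0 => x _; apply: IH => v.
Qed.

Lemma measurable_cons_tuple d (T : measurableType d) m (f : T -> R)
    (g : T -> m.-tuple R) :
  measurable_fun setT f -> measurable_fun setT g ->
  measurable_fun setT (fun x => cons_tuple (f x) (g x)).
Proof.
(* The two tuples have the same underlying sequence and differ only in the proof of its size. *)
move=> mf mg; rewrite (_ : (fun x => _) =
  fun x => [the m.+1.-tuple R of f x :: g x]); first exact: measurable_cons.
by apply/funext => x; apply/val_inj.
Qed.

(** The parameter space is arbitrary so that the induction on [m] can move the first coordinate into
    it, replacing [T] by [T * R]. *)
Lemma measurable_iint d (T : measurableType d) m
    (f : T -> m.-tuple R -> \bar R) :
  measurable_fun [set: T * m.-tuple R] (fun z => f z.1 z.2) ->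
  (forall t v, 0 <= f t v) ->
  measurable_fun setT (fun t => iint (f t)).
Proof.
elim: m d T f => [|m IH] d T f mf f0 /=.
  apply: (measurableT_comp mf (f := fun z => f z.1 z.2)
    (g := fun t => (t, [tuple]))).
  exact: measurable_fun_pair.
pose F (z : T * R) := iint (fun v => f z.1 (cons_tuple z.2 v)).
have mF : measurable_fun setT F.
  apply: (IH _ (T * R)%type (fun z v => f z.1 (cons_tuple z.2 v)))
    => [|? ?]; last exact: f0.
  apply: (measurableT_comp mf (f := fun z => f z.1 z.2)
    (g := fun z : T * R * m.-tuple R => (z.1.1, cons_tuple z.1.2 z.2))).
  apply: measurable_fun_pair => /=; first exact: measurableT_comp.
  apply: measurable_cons_tuple => //; exact: measurableT_comp.
apply: (measurable_fun_fubini_tonelli_F (m2 := @lebesgue_measure R) F) => // z.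
exact: iint_ge0.
Qed.

Lemma measurable_iint_cons m (f : m.+1.-tuple R -> \bar R) :
  measurable_fun setT f -> (forall v, 0 <= f v) ->
  measurable_fun [set: R] (fun x => iint (fun v => f (cons_tuple x v))).
Proof.
move=> mf f0.
apply: (@measurable_iint _ R m (fun x v => f (cons_tuple x v))) => //.
exact/(measurableT_comp mf)/measurable_cons_tuple.
Qed.

Lemma measurable_cons_tupler m (f : m.+1.-tuple R -> \bar R) x :
  measurable_fun setT f -> measurable_fun setT (fun v => f (cons_tuple x v)).
Proof. by move=> mf; exact/(measurableT_comp mf)/measurable_cons_tuple. Qed.

Lemma le_iint m (f g : m.-tuple R -> \bar R) :
  measurable_fun setT f -> measurable_fun setT g ->
  (forall v, 0 <= f v) -> (forall v, f v <= g v) -> iint f <= iint g.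
Proof.
elim: m f g => [|m IH] f g mf mg f0 fg //=.
have g0 v : 0 <= g v by exact: le_trans (fg v).
apply: ge0_le_integral => //= [x _|||x _].
- exact: iint_ge0.
- exact: measurable_iint_cons.
- exact: measurable_iint_cons.
- by apply: IH => //; exact: measurable_cons_tupler.
Qed.

Lemma iintD m (f g : m.-tuple R -> \bar R) :
  measurable_fun setT f -> measurable_fun setT g ->
  (forall v, 0 <= f v) -> (forall v, 0 <= g v) ->
  iint (fun v => f v + g v) = iint f + iint g.
Proof.
elim: m f g => [|m IH] f g mf mg f0 g0 //=.
rewrite -ge0_integralD//=; last 4 first.
- by move=> x _; exact: iint_ge0.
- exact: measurable_iint_cons.
- by move=> x _; exact: iint_ge0.
- exact: measurable_iint_cons.
by apply: eq_integral => x _; rewrite IH//; exact: measurable_cons_tupler.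
Qed.

Lemma iintZl m (f : m.-tuple R -> \bar R) k :
  measurable_fun setT f -> (forall v, 0 <= f v) -> 0 <= k ->
  iint (fun v => k * f v) = k * iint f.
Proof.
move=> + + k0; elim: m f => [|m IH] f mf f0 //=.
rewrite -ge0_integralZl//=; last 2 first.
- exact: measurable_iint_cons.
- by move=> x _; exact: iint_ge0.
by apply: eq_integral => x _; rewrite IH//; exact: measurable_cons_tupler.
Qed.

(** Induction on [m]: two-dimensional Tonelli moves the outer variable past the first coordinate,
    the induction hypothesis past the others. *)
Lemma integral_iint_exchange m (f : R -> m.-tuple R -> \bar R) :
  measurable_fun [set: R * m.-tuple R] (fun z => f z.1 z.2) ->
  (forall x v, 0 <= f x v) ->
  \int[@lebesgue_measure R]_x iint (f x) =
  iint (fun v => \int[@lebesgue_measure R]_x f x v).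
Proof.
elim: m f => [|m IH] f mf f0 //=.
have mc (z : R * R -> R * R) : measurable_fun setT z ->
    measurable_fun [set: R * R * m.-tuple R]
    (fun t => f (z t.1).1 (cons_tuple (z t.1).2 t.2)).
  move=> mz.
  apply: (measurableT_comp mf (f := fun z => f z.1 z.2)
    (g := fun t : R * R * m.-tuple R =>
      ((z t.1).1, cons_tuple (z t.1).2 t.2))).
  have mz1 : measurable_fun setT (fun t : R * R * m.-tuple R => z t.1)
    by exact: measurableT_comp.
  apply: measurable_fun_pair => /=; first exact: measurableT_comp.
  by apply: measurable_cons_tuple => //; exact: measurableT_comp.
rewrite (@fubini_tonelli _ _ _ _ R (@lebesgue_measure R) (@lebesgue_measure R)
  (fun z => iint (fun v => f z.1 (cons_tuple z.2 v))))/=; last 2 first.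
- by apply: (@measurable_iint _ (R * R)%type m
    (fun z v => f z.1 (cons_tuple z.2 v))) => //;
    exact: (mc id).
- by move=> z; exact: iint_ge0.
apply: eq_integral => y _; rewrite IH//.
apply: (measurableT_comp mf (f := fun z => f z.1 z.2)
  (g := fun t : R * m.-tuple R => (t.1, cons_tuple y t.2))).
by apply: measurable_fun_pair => //=; exact: measurable_cons_tuple.
Qed.

(** Induction on [m]: the one-variable exchange brings the first coordinate of [x] outside the
    integral over [y], and the induction hypothesis applies under it. *)
Lemma iint_exchange m k (f : m.-tuple R -> k.-tuple R -> \bar R) :
  measurable_fun [set: m.-tuple R * k.-tuple R] (fun z => f z.1 z.2) ->
  (forall x y, 0 <= f x y) ->
  iint (fun x => iint (f x)) = iint (fun y => iint (f ^~ y)).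
Proof.
elim: m f => [|m IH] f mf f0 //=.
have mf1 : measurable_fun [set: (R * k.-tuple R) * m.-tuple R]
    (fun t => f (cons_tuple t.1.1 t.2) t.1.2).
  apply: (measurableT_comp mf (f := fun z => f z.1 z.2)
    (g := fun t : (R * k.-tuple R) * m.-tuple R =>
      (cons_tuple t.1.1 t.2, t.1.2))).
  apply: measurable_fun_pair => /=; last exact: measurableT_comp.
  by apply: measurable_cons_tuple => //; exact: measurableT_comp.
rewrite -(@integral_iint_exchange _
  (fun x y => iint (fun v => f (cons_tuple x v) y))); last 2 first.
- exact: (@measurable_iint _ (R * k.-tuple R)%type m
    (fun z v => f (cons_tuple z.1 v) z.2)).
- by move=> x y; exact: iint_ge0.
apply: eq_integral => x _; apply: (IH (fun v y => f (cons_tuple x v) y)) => //.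
apply: (measurableT_comp mf (f := fun z => f z.1 z.2)
  (g := fun t : m.-tuple R * k.-tuple R => (cons_tuple x t.1, t.2))).
by apply: measurable_fun_pair => //=; exact: measurable_cons_tuple.
Qed.

(** * Affine changes of variables *)

Lemma measurable_affine (a b : R) :
  measurable_fun [set: R] (fun x => a * x + b)%R.
Proof. by apply: measurable_funD => //; exact: measurable_funM. Qed.

(** By uniqueness of Lebesgue measure it suffices to test half-open intervals: for [c < d] the
    preimage of []c, d]] has length [(d - c) / a], and the factor [a] restores [d - c]. *)
Lemma lebesgue_measure_affine (a b : R) (a0 : (0 < a)%R) (A : set R) :
  measurable A ->
  pushforward (mscale (NngNum (ltW a0)) (@lebesgue_measure R))
    (fun x => a * x + b : measurableTypeR R)%R A = lebesgue_measure A.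
Proof.
move=> mA; apply/esym/lebesgue_measure_unique => //=.
  exact: measurable_affine.
move=> _ _ [[c d]] _ <-; rewrite /pushforward/mscale/=.
rewrite (_ : _ @^-1` _ = `]((c - b) / a)%R, ((d - b) / a)%R]%classic); last first.
  apply/seteqP; split=> x /=; rewrite !in_itv/=;
    by rewrite ltr_pdivrMr// ler_pdivlMr// ltrBlDr lerBrDr (mulrC x).
rewrite !lebesgue_measure_itv/= !lte_fin ltr_pM2r ?invr_gt0// ltrD2r.
case: ifPn => _; last by rewrite mule0.
by rewrite -!EFinD -EFinM; congr EFin; field; rewrite gt_eqF.
Qed.

Lemma ge0_integral_affine (a b : R) (f : R -> \bar R) : (0 < a)%R ->
  measurable_fun setT f -> (forall x, 0 <= f x) ->
  \int[@lebesgue_measure R]_x f (a * x + b)%R =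
  a^-1%:E * \int[@lebesgue_measure R]_x f x.
Proof.
move=> a0 mf f0; have ma := measurable_affine a b.
have -> : \int[@lebesgue_measure R]_x f x =
    \int[pushforward (mscale (NngNum (ltW a0)) (@lebesgue_measure R))
      (fun x => a * x + b : measurableTypeR R)%R]_x f x.
  by apply: eq_measure_integral => A mA _; exact/esym/lebesgue_measure_affine.
rewrite ge0_integral_pushforward// preimage_setT ge0_integral_mscale//=.
  by rewrite muleA -EFinM mulVf ?gt_eqF// mul1e.
exact: (measurableT_comp mf).
Qed.

(** Unlike [tscale] and [tsub], this makes sense for the empty tuple too, so an induction can peel
    off coordinates; on nonempty tuples it is the argument of [mu] in [rw_q]. *)
Definition taffine m (a : R) (v b : m.-tuple R) : m.-tuple R :=
  [tuple (a * (tnth v i - tnth b i))%R | i < m].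

Lemma taffine_cons m (a x y : R) (v b : m.-tuple R) :
  taffine a (cons_tuple x v) (cons_tuple y b) =
  cons_tuple (a * (x - y))%R (taffine a v b).
Proof.
apply: eq_from_tnth => i; case: (unliftP ord0 i) => [j|] ->.
  by rewrite tnth_mktuple !tnthS tnth_mktuple.
by rewrite tnth_mktuple !tnth0.
Qed.

Lemma measurable_taffine m (a : R) (b : m.-tuple R) :
  measurable_fun setT (fun v => taffine a v b).
Proof.
apply/measurable_fun_tnthP => i.
rewrite (_ : _ \o _ = fun v : m.-tuple R => a * (tnth v i - tnth b i))%R.
  by apply: measurable_funM => //; apply: measurable_funB => //;
    exact: measurable_tnth.
by apply/funext => v /=; rewrite tnth_mktuple.
Qed.

Lemma cons_tupleP m (v : m.+1.-tuple R) :
  exists x u, v = cons_tuple x u.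
Proof. by case/tupleP: v => x u; exists x, u; apply/val_inj. Qed.

(** Each coordinate contributes one factor [a^-1] by the one-dimensional substitution. *)
Lemma iint_affine m (a : R) (b : m.-tuple R) (f : m.-tuple R -> \bar R) :
  (0 < a)%R -> measurable_fun setT f -> (forall v, 0 <= f v) ->
  iint (fun v => f (taffine a v b)) = (a ^- m)%:E * iint f.
Proof.
move=> a0; elim: m b f => [|m IH] b f mf f0 /=.
  by rewrite expr0 invr1 mul1e; congr f; exact: tuple0.
have [y [u ->]] := cons_tupleP b.
under eq_integral => x _.
  under eq_iint do rewrite taffine_cons.
  rewrite (IH u (fun v => f (cons_tuple _ v)))//; last exact: measurable_cons_tupler.
  over.
have mi := measurable_iint_cons mf f0.
have mg : measurable_fun [set: R] (fun x => a * (x - y))%R.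
  by apply: measurable_funM => //; exact: measurable_funB.
rewrite ge0_integralZl//=; last 3 first.
- exact: (measurableT_comp mi mg).
- by move=> x _; exact: iint_ge0.
- by rewrite lee_fin invr_ge0 exprn_ge0// ltW.
under eq_integral do rewrite mulrBr.
rewrite (ge0_integral_affine _ a0 mi); last by move=> x; exact: iint_ge0.
by rewrite muleA -EFinM exprSr invfM mulrC.
Qed.

Lemma scale1_cons m (a x : R) (v : m.-tuple R) :
  scale1 a (cons_tuple x v) = cons_tuple (a * x)%R v.
Proof.
apply: eq_from_tnth => i; case: (unliftP ord0 i) => [j|] ->.
  by rewrite tnth_mktuple !tnthS.
by rewrite tnth_mktuple eqxx !tnth0.
Qed.

(** Only the first coordinate is dilated, hence a single factor in every dimension. *)
Lemma iint_scale1 m (a : R) (f : m.+1.-tuple R -> \bar R) :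
  (0 < a)%R -> measurable_fun setT f -> (forall v, 0 <= f v) ->
  iint (fun v => f (scale1 a v)) = a^-1%:E * iint f.
Proof.
move=> a0 mf f0 /=.
under eq_integral do under eq_iint do rewrite scale1_cons.
have mi := measurable_iint_cons mf f0.
rewrite -(ge0_integral_affine 0 a0 mi); last by move=> x; exact: iint_ge0.
by under [RHS]eq_integral do rewrite addr0.
Qed.

(** * Strict positivity of integrals *)

(** If the integral were zero, [f] would vanish almost everywhere on [A]; being positive there, it
    would force [A] to be null. *)
Lemma integral_gt0 (A : set R) (f : R -> \bar R) :
  measurable A -> 0 < lebesgue_measure A ->
  measurable_fun A f -> (forall x, A x -> 0 < f x) ->
  0 < \int[@lebesgue_measure R]_(x in A) f x.
Proof.
move=> mA A0 mf f0.
have fge0 x : A x -> 0 <= f x by move=> /f0/ltW.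
rewrite lt_neqAle integral_ge0// andbT; apply/eqP => /esym i0.
suff : lebesgue_measure A = 0 by move=> A_0; rewrite A_0 ltxx in A0.
have /(ae_eq_integral_abs (@lebesgue_measure R) mA mf).1 :
    \int[@lebesgue_measure R]_(x in A) `|f x| = 0.
  rewrite -[RHS]i0; apply: eq_integral => x; rewrite inE => Ax.
  by rewrite gee0_abs// fge0.
move=> [N [mN N0 AN]]; apply: (subset_measure0 _ _ _ N0) => // x Ax.
by apply: AN => /(_ Ax) fx0; have := f0 x Ax; rewrite fx0 ltxx.
Qed.

Lemma iint_gt0 m (f : m.-tuple R -> \bar R) :
  measurable_fun setT f -> (forall v, 0 < f v) -> 0 < iint f.
Proof.
elim: m f => [|m IH] f mf f0 //=.
apply: integral_gt0 => //.
- by rewrite -set_itvNyy lebesgue_measure_itv/= addye// lt0y.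
- by apply: measurable_iint_cons => // v; exact/ltW.
- by move=> x _; apply: IH => //; exact: measurable_cons_tupler.
Qed.
End IteratedIntegral.

(** * Rescaled densities and random walk proposals *)

Section MetropolisHastings.
Context {R : realType} {n : nat}.
Local Notation Rd := (n.+1.-tuple R).
Implicit Types (p f g mu : Rd -> R) (q : Rd -> Rd -> R).

Lemma measurable_scale1 (a : R) : measurable_fun [set: Rd] (scale1 a).
Proof.
apply/measurable_fun_tnthP => i.
rewrite (_ : _ \o _ = fun x : Rd => if i == ord0 then a * tnth x i else tnth x i).
  by case: (i == ord0); [apply: measurable_funM => //|]; exact: measurable_tnth.
by apply/funext => x /=; rewrite tnth_mktuple.
Qed.

Lemma scale1K (a : R) : a != 0 -> cancel (scale1 a^-1) (@scale1 R n a).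
Proof.
move=> a0 x; apply: eq_from_tnth => i; rewrite !tnth_mktuple.
by case: (i == ord0) => //; rewrite mulVKf.
Qed.

Lemma rescaled1 p : rescaled p 1 = p.
Proof.
apply/funext => x; rewrite /rescaled invr1 mul1r; congr p.
by apply: eq_from_tnth => i; rewrite tnth_mktuple mul1r if_same.
Qed.

Lemma rescaled_scale1 p (a : R) x : a != 0 ->
  p x = a * rescaled p a (scale1 a x).
Proof.
move=> a0; rewrite /rescaled mulVKf//; congr p.
(* Cancellation is used at [a^-1], whose inverse is [a]; this gives the composition in the other
   order. *)
by apply/esym; rewrite -{2}(invrK a) scale1K// invr_neq0.
Qed.

Lemma measurable_rescaled p (a : R) :
  measurable_fun setT p -> measurable_fun setT (rescaled p a).
Proof.
move=> mp; apply: measurable_funM => //.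
exact: (measurableT_comp mp (measurable_scale1 _)).
Qed.

Lemma tscale_tsub (a : R) (x y : Rd) : tscale a (tsub y x) = taffine a y x.
Proof. by apply: eq_from_tnth => i; rewrite !tnth_mktuple. Qed.

Lemma measurable_rw_q mu (sigma : R) : measurable_fun setT mu ->
  measurable_fun [set: Rd * Rd] (fun z => rw_q mu sigma z.1 z.2).
Proof.
move=> mmu; apply: measurable_funM => //.
apply: (measurableT_comp mmu); apply/measurable_fun_tnthP => i.
rewrite (_ : _ \o _ =
  fun z : Rd * Rd => sigma^-1 * (tnth z.2 i - tnth z.1 i)); last first.
  by apply/funext => z /=; rewrite !tnth_mktuple.
by apply: measurable_funM => //; apply: measurable_funB;
  exact/(measurableT_comp (measurable_tnth i)).
Qed.

Lemma rw_qC mu (sigma : R) : (forall xi, mu (tscale (-1) xi) = mu xi) ->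
  forall x y, rw_q mu sigma x y = rw_q mu sigma y x.
Proof.
move=> mus x y; rewrite /rw_q -mus; congr (_ * mu _).
by apply: eq_from_tnth => i; rewrite !tnth_mktuple; ring.
Qed.

Lemma rw_q_ge0 mu (sigma : R) : 0 < sigma -> (forall x, 0 <= mu x) ->
  forall x y, 0 <= rw_q mu sigma x y.
Proof. by move=> s0 mu0 x y; rewrite mulr_ge0// invr_ge0 exprn_ge0// ltW. Qed.

(** * The Dirichlet form as a double integral *)

(** A symmetric proposal cancels from the acceptance ratio, leaving [p y / p x]; the flow from [x]
    to [y] is then governed by the symmetric weight [min (p x) (p y)]. *)
Lemma mh_alphaM p q x y : (forall x, 0 < p x) -> q x y = q y x ->
  mh_alpha p q x y * q x y = (p x)^-1 * (Num.min (p x) (p y) * q x y).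
Proof.
move=> p0 qC; rewrite /mh_alpha -qC mulrA.
(* Where [q x y] is zero the ratio divides by zero, but both sides carry the factor [q x y]. *)
have [->|q0] := eqVneq (q x y) 0; first by rewrite !mulr0.
congr (_ * _); rewrite minr_pMr ?invr_ge0 ?ltW// mulVf ?gt_eqF//.
by congr Num.min; field; rewrite q0 gt_eqF.
Qed.

Definition dform_kernel p q f (x y : Rd) : \bar R :=
  (Num.min (p x) (p y) * q x y * (f y - f x) ^+ 2)%:E.

Definition dform p q f : \bar R :=
  iint (fun x => iint (fun y => dform_kernel p q f x y)).

Definition measurable_kernel q :=
  measurable_fun [set: Rd * Rd] (fun z => q z.1 z.2).

Lemma measurable_dform_kernel p q f :
  measurable_fun setT p -> measurable_kernel q -> measurable_fun setT f ->
  measurable_fun [set: Rd * Rd] (fun z => dform_kernel p q f z.1 z.2).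
Proof.
move=> mp mq mf; apply/measurable_EFinP; apply: measurable_funM.
  apply: measurable_funM => //.
  by apply: measurable_minr; exact: measurableT_comp.
by apply: measurable_funX; apply: measurable_funB; exact: measurableT_comp.
Qed.

Lemma dform_kernel_ge0 p q f x y : (forall x, 0 < p x) ->
  (forall x y, 0 <= q x y) -> (0 <= dform_kernel p q f x y)%E.
Proof.
move=> p0 q0; rewrite lee_fin mulr_ge0 ?sqr_ge0// mulr_ge0//.
by rewrite le_min !ltW.
Qed.

Lemma measurable_slice m k (F : m.-tuple R -> k.-tuple R -> \bar R) x :
  measurable_fun [set: m.-tuple R * k.-tuple R] (fun z => F z.1 z.2) ->
  measurable_fun setT (F x).
Proof.
by move=> mF; exact: (measurableT_comp (f := fun z => F z.1 z.2) mF
  (pair1_measurable x)).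
Qed.

Lemma measurable_dform_kernelr p q f x :
  measurable_fun setT p -> measurable_kernel q -> measurable_fun setT f ->
  measurable_fun setT (dform_kernel p q f x).
Proof.
by move=> mp mq mf; apply: (@measurable_slice _ _ (dform_kernel p q f));
  exact: measurable_dform_kernel.
Qed.

Lemma dirichletE p q f :
  measurable_fun setT p -> (forall x, 0 < p x) ->
  measurable_kernel q -> (forall x y, 0 <= q x y) ->
  (forall x y, q x y = q y x) -> measurable_fun setT f ->
  dirichlet p q f = (2^-1%:E * dform p q f)%E.
Proof.
move=> mp p0 mq q0 qC mf; congr (_ * _)%E; apply: eq_iint => x.
(* The rejection part sits at [y = x], where the increment of [f] is zero; the product vanishes
   whatever extended real [mh_r] is. *)
rewrite /mh_kint subrr (expr2 (0 : R)) mulr0 mule0 adde0.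
under eq_iint => y do rewrite mh_alphaM// -EFinM -mulrA EFinM.
rewrite (@iintZl _ _ (dform_kernel p q f x)); last 3 first.
- exact: measurable_dform_kernelr.
- by move=> y; exact: dform_kernel_ge0.
- by rewrite lee_fin invr_ge0 ltW.
by rewrite muleA -EFinM mulfV ?gt_eqF// mul1e.
Qed.

Lemma iint_dform_kernel_ge0 p q f x : (forall x, 0 < p x) ->
  (forall x y, 0 <= q x y) -> (0 <= iint (dform_kernel p q f x))%E.
Proof. by move=> p0 q0; apply: iint_ge0 => y; exact: dform_kernel_ge0. Qed.

Lemma measurable_iint_dform_kernel p q f :
  measurable_fun setT p -> measurable_kernel q -> measurable_fun setT f ->
  (forall x, 0 < p x) -> (forall x y, 0 <= q x y) ->
  measurable_fun setT (fun x => iint (dform_kernel p q f x)).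
Proof.
move=> mp mq mf p0 q0; apply: (@measurable_iint _ _ Rd).
  exact: measurable_dform_kernel.
by move=> x y; exact: dform_kernel_ge0.
Qed.

Lemma le_dform p q q' f :
  measurable_fun setT p -> (forall x, 0 < p x) ->
  measurable_kernel q -> measurable_kernel q' -> (forall x y, 0 <= q x y) ->
  (forall x y, q x y <= q' x y) -> measurable_fun setT f ->
  (dform p q f <= dform p q' f)%E.
Proof.
move=> mp p0 mq mq' q0 qq' mf.
have q'0 x y : 0 <= q' x y by exact: le_trans (qq' x y).
apply: le_iint => [|||x].
- exact: measurable_iint_dform_kernel.
- exact: measurable_iint_dform_kernel.
- by move=> x; exact: iint_dform_kernel_ge0.
apply: le_iint => [|||y].
- exact: measurable_dform_kernelr.
- exact: measurable_dform_kernelr.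
- by move=> y; exact: dform_kernel_ge0.
rewrite lee_fin ler_wpM2r ?sqr_ge0// ler_wpM2l//.
by rewrite le_min !ltW.
Qed.

(** * Transport under the dilation *)

Lemma rescaled_gt0 p (a : R) x : 0 < a -> (forall x, 0 < p x) ->
  0 < rescaled p a x.
Proof. by move=> a0 p0; rewrite mulr_gt0 ?invr_gt0. Qed.

(* Each of the two integrations contributes a factor [a]; one of them is
   absorbed by the normalisation of the rescaled density. *)
Lemma dform_rescaled p q f (a : R) : 0 < a ->
  measurable_fun setT p -> (forall x, 0 < p x) ->
  measurable_kernel q -> (forall x y, 0 <= q x y) -> measurable_fun setT f ->
  dform (rescaled p a) q f =
  (a%:E * dform p (fun x y => q (scale1 a x) (scale1 a y)) (f \o scale1 a))%E.
Proof.
move=> a0 mp p0 mq q0 mf; have an0 : a != 0 by rewrite gt_eqF.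
set p' := rescaled p a.
have mp' : measurable_fun setT p' by exact: measurable_rescaled.
have p'0 x : 0 < p' x by exact: rescaled_gt0.
have kE x y : dform_kernel p (fun x y => q (scale1 a x) (scale1 a y))
    (f \o scale1 a) x y =
    (a%:E * dform_kernel p' q f (scale1 a x) (scale1 a y))%E.
  rewrite /dform_kernel (rescaled_scale1 p x an0) (rescaled_scale1 p y an0).
  by rewrite -minr_pMr ?ltW// -EFinM !mulrA.
have mk x : measurable_fun setT (dform_kernel p' q f x).
  exact: measurable_dform_kernelr.
have k0 x y := dform_kernel_ge0 f x y p'0 q0.
rewrite [in RHS]/dform.
under [in RHS]eq_iint => x.
  under eq_iint => y do rewrite kE.
  rewrite (@iint_scale1 _ _ a
    (fun y => a%:E * dform_kernel p' q f (scale1 a x) y)%E)//; last 2 first.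
  - exact: measurable_funeM.
  - by move=> y; rewrite mule_ge0// lee_fin ltW.
  rewrite iintZl ?lee_fin ?ltW// muleA -EFinM mulVf// mul1e.
  over.
rewrite (@iint_scale1 _ _ a (fun x => iint (dform_kernel p' q f x)))//.
- by rewrite muleA -EFinM mulfV// mul1e.
- exact: measurable_iint_dform_kernel.
- by move=> x; exact: iint_dform_kernel_ge0.
Qed.

(** The Jacobian [a] of the dilation cancels the factor [a^-1] in [rescaled]. *)
Lemma iint_rescaled p f (a : R) : 0 < a ->
  measurable_fun setT p -> (forall x, 0 < p x) ->
  measurable_fun setT f -> (forall x, 0 <= f x) ->
  iint (fun x => (f x * rescaled p a x)%:E) =
  iint (fun x => (f (scale1 a x) * p x)%:E).
Proof.
move=> a0 mp p0 mf f0; have an0 : a != 0 by rewrite gt_eqF.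
have mfp : measurable_fun setT (fun x => (f x * rescaled p a x)%:E).
  apply/measurable_EFinP; apply: measurable_funM => //.
  exact: measurable_rescaled.
have fp0 x : (0 <= (f x * rescaled p a x)%:E)%E.
  by rewrite lee_fin mulr_ge0// ltW// rescaled_gt0.
under [RHS]eq_iint => x do
  rewrite (rescaled_scale1 p x an0) mulrCA EFinM.
rewrite (@iint_scale1 _ _ a (fun x => a%:E * (f x * rescaled p a x)%:E)%E)//.
- by rewrite iintZl ?lee_fin ?ltW// muleA -EFinM mulVf// mul1e.
- exact: measurable_funeM.
- by move=> x; rewrite mule_ge0// lee_fin ltW.
Qed.

Lemma expect_rescaled p f (a : R) : 0 < a ->
  measurable_fun setT p -> (forall x, 0 < p x) -> measurable_fun setT f ->
  expect (rescaled p a) f = expect p (f \o scale1 a).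
Proof.
move=> a0 mp p0 mf; rewrite /expect.
rewrite (@iint_rescaled p (fun x => Num.max (f x) 0))//; last 2 first.
- exact: measurable_maxr.
- by move=> x; rewrite le_max lexx orbT.
rewrite (@iint_rescaled p (fun x => Num.max (- f x) 0))//.
- by apply: measurable_maxr => //; exact: measurableT_comp.
- by move=> x; rewrite le_max lexx orbT.
Qed.

Lemma variance_expect0 p f : expect p f = 0%E ->
  Defs.variance p f = iint (fun x => (f x ^+ 2 * p x)%:E).
Proof.
move=> f0; apply: eq_iint => x.
by rewrite f0 sube0 -EFin_expe -EFinM.
Qed.

Lemma L2_01_rescaled p f (a : R) : 0 < a ->
  measurable_fun setT p -> (forall x, 0 < p x) -> measurable_fun setT f ->
  L2_01 (rescaled p a) f <-> L2_01 p (f \o scale1 a).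
Proof.
move=> a0 mp p0 mf.
have mfa : measurable_fun setT (f \o scale1 a).
  exact: (measurableT_comp mf (measurable_scale1 _)).
(* Variances are compared for centred functions only, where they are plain second moments. *)
have varE : expect p (f \o scale1 a) = 0%E ->
    Defs.variance (rescaled p a) f = Defs.variance p (f \o scale1 a).
  move=> E0; rewrite !variance_expect0 ?expect_rescaled//.
  rewrite (@iint_rescaled p (fun x => f x ^+ 2))//.
  - exact: measurable_funX.
  - by move=> x; exact: sqr_ge0.
split=> -[_ []]; rewrite ?expect_rescaled// => E0 V1.
  by split=> //; split=> //; rewrite -varE.
by split=> //; rewrite expect_rescaled//; split=> //; rewrite varE.
Qed.

(** * The strip indicator and its normalisation *)

(** It depends on the first coordinate alone, so the other coordinates can be integrated out to the
    first marginal of [mu]. *)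
Definition strip (x : Rd) : R := \1_(`[0, 1]%classic : set R) (tnth x ord0).

Lemma measurable_strip : measurable_fun setT strip.
Proof.
have m1 : measurable_fun [set: R] (\1_(`[0, 1]%classic : set R) : R -> R).
  exact: measurable_indic.
exact: (measurableT_comp m1 (measurable_tnth _)).
Qed.

Lemma strip01 x : strip x = 0 \/ strip x = 1.
Proof. by rewrite /strip indicE; case: (_ \in _); [right|left]. Qed.

Lemma strip_ge0 x : 0 <= strip x.
Proof. by case: (strip01 x) => ->. Qed.

Lemma strip_cons (x : R) v :
  strip (cons_tuple x v) = \1_(`[0, 1]%classic : set R) x.
Proof. by rewrite /strip tnth0. Qed.

Lemma iint_indic_gt0 (A : set R) p : measurable A ->
  measurable_fun setT p -> (forall x, 0 < p x) ->
  (0 < lebesgue_measure A)%E ->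
  (0 < iint (fun x : Rd => (\1_A (tnth x ord0) * p x)%:E))%E.
Proof.
move=> mA mp p0 A0 /=.
rewrite (_ : (\int[_]_x _)%E = (\int[@lebesgue_measure R]_(x in A)
    iint (fun v => (p (cons_tuple x v))%:E))%E).
  have mpc x : measurable_fun setT (fun v => (p (cons_tuple x v))%:E).
    apply: (@measurable_cons_tupler _ _ (EFin \o p)).
    exact/measurable_EFinP.
  apply: integral_gt0 => //.
  - apply: measurable_funS (@measurable_iint_cons _ _ (EFin \o p) _ _) => //.
      exact/measurable_EFinP.
    by move=> v; rewrite lee_fin ltW.
  - by move=> x _; apply: iint_gt0 => // v; rewrite lte_fin.
rewrite [RHS]integral_mkcond; apply: eq_integral => x _.
rewrite patchE; under eq_iint do rewrite tnth0 indicE.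
case: ifPn => xA; first by under eq_iint do rewrite mul1r.
under eq_iint do rewrite mul0r.
(* Off [A] the integrand is zero, and so is its iterated integral, by induction on the number of
   remaining coordinates. *)
by elim: (n) => [//|m IH] /=; under eq_integral do rewrite IH; rewrite integral0.
Qed.

(** Both masses have to be positive because the standard deviation [sqrt (a * b)] of the indicator
    is divided out in [test_fun]. *)
Lemma strip_mass p : is_density p -> (forall x, 0 < p x) ->
  exists a b : R, [/\ 0 < a, 0 < b, a + b = 1,
    iint (fun x => (strip x * p x)%:E) = a%:E &
    iint (fun x => ((1 - strip x) * p x)%:E) = b%:E].
Proof.
move=> [mp [_ p1]] p0.
have mC := measurableC (measurable_itv `[0, 1] : measurable (`[0, 1]%classic : set R)).
have Ipos : (0 < iint (fun x => (strip x * p x)%:E))%E.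
  apply: iint_indic_gt0 => //.
  by rewrite lebesgue_measure_itv/= lte_fin ltr01 sube0 lte_fin.
have Jpos : (0 < iint (fun x => ((1 - strip x) * p x)%:E))%E.
  under eq_iint => x.
    rewrite (_ : 1 - strip x = \1_(~` `[0, 1]%classic : set R) (tnth x ord0));
      last first.
      by rewrite /strip !indicE in_setC; case: (_ \in _) => /=; rewrite ?subrr ?subr0.
    over.
  apply: iint_indic_gt0 => //.
  (* Any interval of positive length away from the unit interval shows that the complement is not
     null. *)
  apply: (@lt_le_trans _ _ (lebesgue_measure (`[2, 3]%classic : set R))).
    rewrite lebesgue_measure_itv/= lte_fin (_ : (2 < 3 :> R)); last by lra.
    by rewrite -EFinB lte_fin; lra.
  apply: le_measure; rewrite ?inE// => x /=; rewrite !in_itv/=.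
  by move=> /andP[x2 _] /andP[_ /(le_trans x2)]; rewrite leNgt ltr1n.
have : (iint (fun x => (strip x * p x)%:E) +
    iint (fun x => ((1 - strip x) * p x)%:E) = 1)%E.
  rewrite -iintD.
  - by rewrite -p1; apply: eq_iint => x; rewrite -EFinD; congr EFin; ring.
  - apply/measurable_EFinP; apply: measurable_funM => //; exact: measurable_strip.
  - apply/measurable_EFinP; apply: measurable_funM => //.
    by apply: measurable_funB => //; exact: measurable_strip.
  - by move=> x; rewrite lee_fin mulr_ge0 ?strip_ge0// ltW.
  - move=> x; rewrite lee_fin mulr_ge0 ?(ltW (p0 _))//.
    by case: (strip01 x) => ->; rewrite ?subr0 ?subrr.
move: Ipos Jpos.
(* Infinite masses are excluded by positivity and by the sum being one. *)
case: (iint (fun x => (strip x * p x)%:E)) => [a| |]//;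
  case: (iint (fun x => ((1 - strip x) * p x)%:E)) => [b| |]//.
rewrite !lte_fin => a0 b0 [ab]; exists a, b; split=> //.
Qed.

(** For [b = 1 - a] this is a standardised Bernoulli variable of success probability [a]. *)
Definition test_fun (a b : R) (x : Rd) : R := (strip x - a) / Num.sqrt (a * b).

Lemma measurable_test_fun a b : measurable_fun setT (test_fun a b).
Proof.
by apply: measurable_funM => //; apply: measurable_funB => //;
  exact: measurable_strip.
Qed.

Lemma L2_01_test_fun p (a b : R) : measurable_fun setT p ->
  (forall x, 0 < p x) -> 0 < a -> 0 < b -> a + b = 1 ->
  iint (fun x => (strip x * p x)%:E) = a%:E ->
  iint (fun x => ((1 - strip x) * p x)%:E) = b%:E ->
  L2_01 p (test_fun a b).
Proof.
move=> mp p0 a0 b0 ab Ea Eb.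
set s := Num.sqrt (a * b).
have s0 : 0 < s by rewrite sqrtr_gt0 mulr_gt0.
have s2 : s ^+ 2 = a * b by rewrite sqr_sqrtr// ltW// mulr_gt0.
have ms : measurable_fun setT (fun x => (strip x * p x)%:E).
  by apply/measurable_EFinP; apply: measurable_funM => //; exact: measurable_strip.
have mt : measurable_fun setT (fun x => ((1 - strip x) * p x)%:E).
  apply/measurable_EFinP; apply: measurable_funM => //.
  by apply: measurable_funB => //; exact: measurable_strip.
have ps x : (0 <= (strip x * p x)%:E)%E.
  by rewrite lee_fin mulr_ge0 ?strip_ge0// ltW.
have pt x : (0 <= ((1 - strip x) * p x)%:E)%E.
  rewrite lee_fin mulr_ge0 ?(ltW (p0 _))//.
  by case: (strip01 x) => ->; rewrite ?subr0 ?subrr.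
have E0 : expect p (test_fun a b) = 0%E.
  rewrite /expect.
  have Es : (1 - a) / s = b / s by rewrite -ab addrC addKr.
  have as0 : 0 < a / s by rewrite divr_gt0.
  have bs0 : 0 < b / s by rewrite divr_gt0.
  (* The positive part is [b / s] on the strip and the negative part [a / s] off it; both integrate
     to [a * b / s]. *)
  under eq_iint => x.
    rewrite (_ : _ * p x = b / s * (strip x * p x)); last first.
      rewrite mulrA; congr (_ * _); rewrite /test_fun -/s.
      case: (strip01 x) => ->; first by rewrite mulr0 max_r// sub0r mulNr oppr_le0 ltW.
      by rewrite Es mulr1 max_l// ltW.
    rewrite EFinM; over.
  under [X in (_ - X)%E]eq_iint => x.
    rewrite (_ : _ * p x = a / s * ((1 - strip x) * p x)); last first.
      rewrite mulrA; congr (_ * _); rewrite /test_fun -/s.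
      case: (strip01 x) => ->.
        by rewrite subr0 mulr1 sub0r mulNr opprK max_l// ltW.
      by rewrite Es subrr mulr0 max_r// oppr_le0 ltW.
    rewrite EFinM; over.
  rewrite !iintZl ?lee_fin ?ltW// Ea Eb -!EFinM -EFinB; congr EFin; ring.
split; first exact: measurable_test_fun.
split=> //; rewrite variance_expect0//.
(* The square is [b / a] on the strip, of mass [a], and [a / b] off it, of mass [b]; the integral is
   [b + a]. *)
under eq_iint => x.
  rewrite (_ : _ * p x = b / a * (strip x * p x) + a / b * ((1 - strip x) * p x));
    last first.
    rewrite !mulrA -mulrDl; congr (_ * _).
    rewrite /test_fun expr_div_n -/s s2.
    case: (strip01 x) => ->; first by field; rewrite !gt_eqF.
    rewrite (_ : 1 - a = b); last by rewrite -ab addrC addKr.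
    by field; rewrite !gt_eqF.
  rewrite EFinD (EFinM (b / a)) (EFinM (a / b)); over.
rewrite iintD; last 4 first.
- exact: measurable_funeM.
- exact: measurable_funeM.
- by move=> x; rewrite mule_ge0// lee_fin divr_ge0// ltW.
- by move=> x; rewrite mule_ge0// lee_fin divr_ge0// ltW.
rewrite !iintZl ?lee_fin ?divr_ge0 ?ltW// Ea Eb -!EFinM -EFinD -ab; congr EFin.
by field; rewrite !gt_eqF.
Qed.

(** * Upper estimate of the Dirichlet form *)

(** For a fixed first coordinate of [y], integrating out the others leaves [sigma^-1] times the
    first marginal of [mu] at a point depending on [a]. The bound [M] holds at every point, hence
    uniformly in [a], and the strip has width one. *)
Lemma iint_rw_q_strip_le mu (sigma M a : R) x : 0 < sigma ->
  measurable_fun setT mu -> (forall x, 0 <= mu x) ->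
  (forall xi1 : R,
     (iint (fun v : n.-tuple R => (mu (cons_tuple xi1 v))%:E) <= M%:E)%E) ->
  (iint (fun y => (rw_q mu sigma (scale1 a x) (scale1 a y) * strip y)%:E)
   <= (M / sigma)%:E)%E.
Proof.
move=> s0 mmu mu0 muM.
have M0 : 0 <= M.
  by rewrite -lee_fin; apply: le_trans (muM 0); apply: iint_ge0 => v; rewrite lee_fin.
set F := fun y => (rw_q mu sigma (scale1 a x) (scale1 a y) * strip y)%:E.
have mF : measurable_fun setT F.
  apply/measurable_EFinP; apply: measurable_funM; last exact: measurable_strip.
  rewrite /rw_q; under eq_fun do rewrite tscale_tsub.
  apply: measurable_funM => //.
  exact: (measurableT_comp mmu (measurableT_comp
    (measurable_taffine _ _) (measurable_scale1 a))).
have F0 y : (0 <= F y)%E.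
  by rewrite lee_fin mulr_ge0 ?strip_ge0// rw_q_ge0.
have mi : measurable_fun [set: R] (\1_(`[0, 1]%classic : set R) : R -> R).
  exact: measurable_indic.
have miE : measurable_fun [set: R]
    (EFin \o (\1_(`[0, 1]%classic : set R) : R -> R)).
  exact/measurable_EFinP.
apply: (@le_trans _ _ (\int[@lebesgue_measure R]_y
    ((M / sigma)%:E * (\1_(`[0, 1]%classic : set R) y)%:E)))%E; last first.
  rewrite ge0_integralZl//=; last by rewrite lee_fin divr_ge0// ltW.
  rewrite integral_indic//= setIT lebesgue_measure_itv/= lte_fin ltr01.
  by rewrite sube0 mule1.
apply: ge0_le_integral => //.
- by move=> y _; exact: iint_ge0.
- exact: measurable_iint_cons.
- exact: (measurable_funeM _ miE).
move=> y _; change (iint (fun v => F (cons_tuple y v)) <=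
  (M / sigma)%:E * (\1_(`[0, 1]%classic : set R) y)%:E)%E.
have [x1 [u xE]] := cons_tupleP x.
set G := fun v : n.-tuple R => (mu (cons_tuple (sigma^-1 * (a * y - a * x1)) v))%:E.
have mG : measurable_fun setT G.
  by apply: (@measurable_cons_tupler _ _ (EFin \o mu)); exact/measurable_EFinP.
have sV0 : 0 < sigma^-1 by rewrite invr_gt0.
have c0 : 0 <= sigma ^- n.+1 * \1_(`[0, 1]%classic : set R) y.
  by rewrite mulr_ge0// invr_ge0 exprn_ge0// ltW.
rewrite (@eq_iint _ _ _ (fun v => ((sigma ^- n.+1 *
    \1_(`[0, 1]%classic : set R) y)%:E * G (taffine sigma^-1 v u))%E)); last first.
  move=> v; rewrite /F xE /rw_q strip_cons !scale1_cons tscale_tsub taffine_cons.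
  by rewrite /G -EFinM mulrAC.
rewrite iintZl ?lee_fin//; last 2 first.
- exact: (measurableT_comp mG (measurable_taffine _ _)).
- by move=> v; rewrite lee_fin.
rewrite iint_affine//; last by move=> v; rewrite lee_fin.
(* The proposal density is normalised over [n.+1] coordinates, but only [n] of them have been
   substituted. *)
have sE : sigma ^- n.+1 / sigma^-1 ^+ n = sigma^-1.
  by rewrite exprVn invrK exprS; field; rewrite gt_eqF// expf_neq0// gt_eqF.
rewrite muleA -!EFinM mulrAC sE (mulrC M) (mulrAC _ M) [leRHS]EFinM.
by apply: lee_wpmul2l; [rewrite lee_fin mulr_ge0// ltW|exact: muM].
Qed.

Lemma dform_test_fun_le p q (a b K : R) : is_density p -> (forall x, 0 < p x) ->
  measurable_kernel q -> (forall x y, 0 <= q x y) ->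
  (forall x y, q x y = q y x) -> 0 < a -> 0 < b ->
  (forall x, (iint (fun y => (q x y * strip y)%:E) <= K%:E)%E) ->
  (dform p q (test_fun a b) <= ((a * b)^-1 * (K + K))%:E)%E.
Proof.
move=> [mp [_ p1]] p0 mq q0 qC a0 b0 qK.
have K0 : 0 <= K.
  rewrite -lee_fin; apply: le_trans (qK [tuple 0 | i < n.+1]).
  by apply: iint_ge0 => y; rewrite lee_fin mulr_ge0// strip_ge0.
have ab0 : 0 <= (a * b)^-1 by rewrite invr_ge0 mulr_ge0// ltW.
(* Density and indicator sit at different points: integrating over [y] first gives at most
   [K * p x], and [p] then integrates to one. *)
pose F (x y : Rd) : \bar R := ((p x)%:E * (q x y * strip y)%:E)%E.
have F0 x y : (0 <= F x y)%E.
  by rewrite mule_ge0// lee_fin ?mulr_ge0 ?strip_ge0// ltW.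
have mqs : measurable_fun [set: Rd * Rd] (fun z => (q z.1 z.2 * strip z.2)%:E).
  apply/measurable_EFinP; apply: measurable_funM => //.
  by apply: measurableT_comp => //; exact: measurable_strip.
have mF : measurable_fun [set: Rd * Rd] (fun z => F z.1 z.2).
  by apply: emeasurable_funM => //; apply/measurable_EFinP; exact: measurableT_comp.
have mF' : measurable_fun [set: Rd * Rd] (fun z => F z.2 z.1).
  have msw : measurable_fun [set: Rd * Rd] (fun z => (z.2, z.1)).
    exact: measurable_fun_pair.
  exact: (measurableT_comp (f := fun z => F z.1 z.2) mF msw).
have mFx x : measurable_fun setT (F x) by exact: measurable_slice mF.
have mF'x x : measurable_fun setT (F^~ x).
  exact: (@measurable_slice _ _ (fun x y => F y x) x mF').
have miF : measurable_fun setT (fun x => iint (F x)).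
  exact: (@measurable_iint _ _ Rd).
have miF' : measurable_fun setT (fun x => iint (F^~ x)).
  exact: (@measurable_iint _ _ Rd _ (fun x y => F y x)).
have IF : (iint (fun x => iint (F x)) <= K%:E)%E.
  apply: (@le_trans _ _ (iint (fun x => K%:E * (p x)%:E)%E)).
    apply: le_iint => // [|x|x].
    - by apply: measurable_funeM; exact/measurable_EFinP.
    - exact: iint_ge0.
    - rewrite iintZl.
      + rewrite (muleC K%:E); apply: lee_wpmul2l; last exact: qK.
        by rewrite lee_fin ltW.
      + exact: (@measurable_slice _ _ (fun x y => (q x y * strip y)%:E)).
      + by move=> y; rewrite lee_fin mulr_ge0// strip_ge0.
      + by rewrite lee_fin ltW.
  rewrite iintZl ?lee_fin// ?p1 ?mule1//; first exact/measurable_EFinP.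
  by move=> x; rewrite lee_fin ltW.
have mt := measurable_test_fun a b.
apply: (@le_trans _ _ (iint (fun x =>
    (a * b)^-1%:E * (iint (F x) + iint (F^~ x)))%E)).
  apply: le_iint => [|||x].
  - exact: measurable_iint_dform_kernel.
  - by apply: measurable_funeM; exact: emeasurable_funD.
  - by move=> x; exact: iint_dform_kernel_ge0.
  rewrite -iintD// -iintZl//; last 2 first.
  - exact: emeasurable_funD.
  - by move=> y; exact: adde_ge0.
  apply: le_iint => [|||y].
  - exact: measurable_dform_kernelr.
  - by apply: measurable_funeM; exact: emeasurable_funD.
  - by move=> y; exact: dform_kernel_ge0.
  rewrite /dform_kernel /F/= -(EFinM (p x)) -(EFinM (p y)).
  rewrite -EFinD -EFinM lee_fin.
  (* The centring [a] cancels in the increment; only the normalisation remains. *)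
  have -> : (test_fun a b y - test_fun a b x) ^+ 2 =
      (a * b)^-1 * (strip y - strip x) ^+ 2.
    rewrite /test_fun -mulrBl exprMn exprVn sqr_sqrtr ?mulr_ge0 ?ltW//.
    by rewrite mulrC; congr (_ * _ ^+ 2); ring.
  rewrite mulrCA ler_wpM2l// -(qC x y).
  have l1 : Num.min (p x) (p y) * q x y <= p x * q x y.
    by rewrite ler_wpM2r// ge_min lexx.
  have l2 : Num.min (p x) (p y) * q x y <= p y * q x y.
    by rewrite ler_wpM2r// ge_min lexx orbT.
  have l3 : 0 <= p x * q x y by rewrite mulr_ge0// ltW.
  have l4 : 0 <= p y * q x y by rewrite mulr_ge0// ltW.
  by case: (strip01 x) => ->; case: (strip01 y) => ->; lra.
rewrite iintZl//; last 2 first.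
- exact: emeasurable_funD.
- by move=> x; rewrite adde_ge0// iint_ge0.
rewrite EFinM lee_wpmul2l//.
rewrite iintD//; [|by move=> x; exact: iint_ge0|by move=> x; exact: iint_ge0].
(* By Tonelli the transposed term has the same integral as [F], so each contributes at most [K]. *)
by rewrite -(iint_exchange mF)// EFinD leeD.
Qed.
End MetropolisHastings.

(** * The two bounds on the gap *)

Theorem theorem2p1 (R : realType) (n : nat)
  (pi mu : n.+1.-tuple R -> R) (sigma : R) :
  (* pi: strictly positive probability density on R^d (d = n.+1), log pi in C^1 *)
  is_density pi -> (forall x, 0 < pi x) -> log_C1 pi ->
  (* mu: symmetric (centred) probability density on R^d *)
  is_density mu ->
  (forall xi, mu (tscale (-1) xi) = mu xi) ->
  (* mu(delta_lambda) >= mu(delta) for all x, y and all lambda < lambda0 *)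
  (exists2 lam0 : R, 0 < lam0 &
     forall (x y : n.+1.-tuple R) (lam : R), 0 < lam < lam0 ->
       mu (scale1 lam (tsub y x)) >= mu (tsub y x)) ->
  (* sup_{xi_1} mu_1(xi_1) < oo *)
  (exists M : R, forall xi1 : R,
     (iint (fun v : n.-tuple R => (mu (cons_tuple xi1 v))%:E) <= M%:E)%E) ->
  0 < sigma ->
  (* Gap(P^R_1) > 0 *)
  (0 < Gap (rescaled pi 1) (rw_q mu sigma))%E ->
  (* Gap(P^R_lambda) = Theta(lambda) as lambda decreases to 0 *)
  exists c C : R, 0 < c /\ 0 < C /\
    \forall lam \near 0^'+,
      ((c * lam)%:E <= Gap (rescaled pi lam) (rw_q mu sigma) <= (C * lam)%:E)%E.
Proof.
move=> dpi pi0 _ dmu mus [lam0 lam00 mono] [M muM] s0 gap1.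
have [mpi _] := dpi; have [mmu [mu0 _]] := dmu.
rewrite rescaled1 in gap1.
pose q := rw_q mu sigma.
have mq : measurable_kernel q by exact: measurable_rw_q.
have q0 x y : 0 <= q x y by exact: rw_q_ge0.
have qC x y : q x y = q y x by exact: rw_qC.
(* The proposal density read in the coordinates in which the target is [pi] itself. *)
pose ql (lam : R) x y := q (scale1 lam x) (scale1 lam y).
have mql lam : measurable_kernel (ql lam).
  have mS : measurable_fun [set: n.+1.-tuple R * n.+1.-tuple R]
      (fun z => (scale1 lam z.1, scale1 lam z.2)).
    by apply: measurable_fun_pair; apply: measurableT_comp => //;
      exact: measurable_scale1.
  exact: (measurableT_comp (f := fun z => q z.1 z.2) mq mS).
have qql lam x y : 0 < lam < lam0 -> q x y <= ql lam x y.
  move=> lamP; rewrite /ql /q /rw_q ler_wpM2l//.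
    by rewrite invr_ge0 exprn_ge0// ltW.
  set z := tscale sigma^-1 (tsub y x).
  (* Taking the origin as starting point makes the difference in the hypothesis equal to the scaled
     increment [z]. *)
  have := mono [tuple 0 | i < n.+1] z lam lamP.
  rewrite (_ : tsub z _ = z); last first.
    by apply: eq_from_tnth => i; rewrite !tnth_mktuple subr0.
  rewrite (_ : scale1 lam z = tscale sigma^-1 (tsub (scale1 lam y) (scale1 lam x)))//.
  apply: eq_from_tnth => i; rewrite !tnth_mktuple.
  by case: (i == ord0) => //; ring.
have dirE lam f : 0 < lam -> measurable_fun setT f ->
    dirichlet (rescaled pi lam) q f =
    (lam%:E * (2^-1%:E * dform pi (ql lam) (f \o scale1 lam)))%E.
  move=> l0 mf; rewrite dirichletE//; last 2 first.
  - exact: measurable_rescaled.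
  - by move=> x; exact: rescaled_gt0.
  by rewrite dform_rescaled// muleCA.
(* The gap is an extended real; were it infinite, the constant 1 would do. *)
have [c c0 cgap] : exists2 c : R, 0 < c & (c%:E <= Gap pi q)%E.
  move: gap1; rewrite -/q; case: (Gap pi q) => [r| |]//.
  - by rewrite lte_fin => r0; exists r.
  - by exists 1; rewrite ?leey.
have [a [b [a0 b0 ab Ea Eb]]] := strip_mass dpi pi0.
have M0 : 0 <= M.
  by rewrite -lee_fin; apply: le_trans (muM 0); apply: iint_ge0 => v; rewrite lee_fin.
(* The half in the Dirichlet form absorbs the two equal contributions [M / sigma]. *)
pose C := (a * b)^-1 * (M / sigma).
(* Only [0 <= M] has been established, so 1 is added to make the upper constant positive. *)
exists c, (C + 1); split=> //; split.
  by rewrite ltr_wpDl// mulr_ge0 ?invr_ge0 ?divr_ge0 ?mulr_ge0// ltW.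
near=> lam.
have l0 : 0 < lam by near: lam; exact: nbhs_right_gt.
have l0' : 0 <= lam by exact: ltW.
have llam0 : lam < lam0 by near: lam; exact: nbhs_right_lt.
apply/andP; split.
  (* Lower bound: each [f] admissible for the rescaled target yields [f \o scale1 lam], admissible
     for [pi]. *)
  apply: le_ereal_inf_tmp => _ [f Lf <-]; have mf := Lf.1.
  rewrite dirE// mulrC EFinM lee_wpmul2l//.
  apply: (le_trans cgap).
  have mfS : measurable_fun setT (f \o scale1 lam).
    exact: (measurableT_comp mf (measurable_scale1 _)).
  apply: (@le_trans _ _ (dirichlet pi q (f \o scale1 lam))).
    apply: ereal_inf_lbound; exists (f \o scale1 lam) => //.
    exact/L2_01_rescaled.
  rewrite (dirichletE mpi pi0 mq q0 qC mfS).
  apply: lee_wpmul2l; first by rewrite lee_fin invr_ge0.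
  by apply: le_dform => // x y; apply: qql; rewrite l0.
(* Upper bound: in the original coordinates this is the normalised indicator of the thin strip where
   the first coordinate lies between 0 and [lam]. *)
pose f : n.+1.-tuple R -> R := test_fun a b \o scale1 lam^-1.
have mt := @measurable_test_fun R n a b.
have mf : measurable_fun setT f.
  exact: (measurableT_comp mt (measurable_scale1 _)).
have fS : f \o scale1 lam = test_fun a b.
  apply/funext => x; rewrite /f /=; congr test_fun.
  by rewrite -{2}(invrK lam) scale1K// invr_eq0 gt_eqF.
apply: (@le_trans _ _ (dirichlet (rescaled pi lam) q f)).
  apply: ereal_inf_lbound; exists f => //.
  by apply/L2_01_rescaled => //; rewrite fS; exact: L2_01_test_fun.
rewrite dirE// fS mulrC EFinM lee_wpmul2l//.
apply: (@le_trans _ _ C%:E); last by rewrite lee_fin lerDl.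
have qls x := @iint_rw_q_strip_le R n mu sigma M lam x s0 mmu mu0 muM.
have := @dform_test_fun_le R n pi (ql lam) a b (M / sigma) dpi pi0 (mql lam)
  (fun x y => q0 _ _) (fun x y => qC _ _) a0 b0 qls.
have h0 : (0 <= (2^-1 : R)%:E)%E by rewrite lee_fin.
move=> /(lee_wpmul2l h0) /le_trans; apply; rewrite -EFinM lee_fin /C.
rewrite mulrCA; apply: ler_wpM2l; last by lra.
by rewrite invr_ge0 mulr_ge0// ltW.
Unshelve. all: by end_near.
Qed.
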